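(* Let $\mathbb{K}\in\{\mathbb{R},\mathbb{C}\}$. Let $\mathcal{X}$ and $(\mathcal{Y},d_{\mathcal{Y}})$ be metric spaces such that $\mathcal{X}$ has the input-CEDAP with mappings $E_{K,n}^{\mathcal{X}}, D_{K,n}^{\mathcal{X}}$ ($K\subseteq\mathcal{X}$ compact, $n\in\mathbb{N}$) and $\mathcal{Y}$ has the output-CEDAP with mappings $E_{K',n}^{\mathcal{Y}}, D_{K',n}^{\mathcal{Y}}$ ($K'\subseteq\mathcal{Y}$ compact, $n\in\mathbb{N}$). Let $\mathcal{F}$ be a universal function approximator. Then for every continuous $G:\mathcal{X}\to\mathcal{Y}$ and every compact $K\subseteq\mathcal{X}$ there exist a sequence $(\varphi_{K,n})_{n\in\mathbb{N}}$ in $\mathcal{F}$, with $\varphi_{K,n}:\mathbb{K}^{w_{\mathcal{X}}(K,n)}\to\mathbb{K}^{w_{\mathcal{Y}}(K',n)}$, and a compact $K'\subseteq\mathcal{Y}$ such that $$\sup_{f\in K} d_{\mathcal{Y}}\Big(G(f),\,\big(D_{K',n}^{\mathcal{Y}}\circ\varphi_{K,n}\circ E_{K,n}^{\mathcal{X}}\big)(f)\Big)\xrightarrow{n\to\infty}0 .$$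
   Context: Input-CEDAP: a metric space $(\mathcal{X},d)$ has the input-CEDAP if for every compact $K\subseteq\mathcal{X}$ there are mappings $E_{K,n}^{\mathcal{X}}:K\to\mathbb{K}^{w_{\mathcal{X}}(K,n)}$ (possibly discontinuous, $w_{\mathcal{X}}(K,n)\in\mathbb{N}$) and $D_{K,n}^{\mathcal{X}}:\overline{E_{K,n}^{\mathcal{X}}(K)}\to\mathcal{X}$, $n\in\mathbb{N}$, such that: (i) $E_{K,n}^{\mathcal{X}}(K)$ is bounded for every $n$; (ii) $D_{K,n}^{\mathcal{X}}$ is continuous; (iii) $\sup_{f\in K} d(f,D_{K,n}^{\mathcal{X}}(E_{K,n}^{\mathcal{X}}(f)))\to0$ as $n\to\infty$. Output-CEDAP: a metric space $(\mathcal{Y},d)$ has the output-CEDAP if for every compact $K\subseteq\mathcal{Y}$ there are mappings $E_{K,n}^{\mathcal{Y}}:\mathcal{Y}\to\mathbb{K}^{w_{\mathcal{Y}}(K,n)}$ and $D_{K,n}^{\mathcal{Y}}:\mathbb{K}^{w_{\mathcal{Y}}(K,n)}\to\mathcal{Y}$, $n\in\mathbb{N}$, such that: (i) $E_{K,n}^{\mathcal{Y}}$ is continuous on $K$; (ii) $D_{K,n}^{\mathcal{Y}}$ is uniformly continuous; (iii) $\sup_{f\in K} d(f,D_{K,n}^{\mathcal{Y}}(E_{K,n}^{\mathcal{Y}}(f)))\to0$ as $n\to\infty$. Universal function approximator: a set $\mathcal{F}$ of functions $\mathbb{K}^a\to\mathbb{K}^b$ (with varying $a,b\in\mathbb{N}$;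 members may be discontinuous) such that for any $a,b\in\mathbb{N}$, compact $C\subset\mathbb{K}^a$ and continuous $f:C\to\mathbb{K}^b$ there is a sequence $(f_n)_{n\in\mathbb{N}}$ of functions $\mathbb{K}^a\to\mathbb{K}^b$ in $\mathcal{F}$ with $\sup_{x\in C}|f(x)-f_n(x)|\to0$, where $|\cdot|$ is the Euclidean norm. *)

(* Defs.v *)
From HB Require Import structures.
From mathcomp Require Import all_boot all_order all_algebra.
From mathcomp Require Import all_classical all_reals all_analysis.
From mathcomp Require Export complex.
Export numFieldNormedType.Exports.

Set Implicit Arguments.
Unset Strict Implicit.
Unset Printing Implicit Defensive.

Import Order.TTheory GRing.Theory Num.Theory.
Local Open Scope classical_set_scope.
Local Open Scope ring_scope.

Inductive scalar_kind := RealScalar | ComplexScalar.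

Definition scalar_field (R : realType) (s : scalar_kind) : numFieldType :=
  match s with RealScalar => R | ComplexScalar => R[i] end.

(* The norm of a numFieldType takes its values in the field itself; this is
   the R-valued absolute value. *)
Definition scalar_abs (R : realType) (s : scalar_kind) : scalar_field R s -> R :=
  match s return scalar_field R s -> R with
  | RealScalar => fun x : R => `|x|
  | ComplexScalar => fun z : R[i] => Normc.normc z
  end.

(* 'rV_a carries the sup norm in the library. It induces the same topology,
   uniformity and bounded sets as the Euclidean norm. *)
Definition eucl_norm (R : realType) (s : scalar_kind) (a : nat)
    (v : 'rV[scalar_field R s]_a) : R :=
  Num.sqrt (\sum_(i < a) scalar_abs (v ord0 i) ^+ 2).

(* Supremum in [0, +oo] of a nonnegative function. Inserting 0 makes it 0
   (rather than -oo) when T is empty and changes nothing otherwise. *)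
Definition sup_ge0 (R : realType) (T : Type) (h : T -> R) : \bar R :=
  ereal_sup (0%E |` [set (h t)%:E | t in [set: T]]).

(* [A : set U] used as a type is the subtype [set_type A], with the subspace
   topology. *)
Definition into_closure (T : Type) (U : topologicalType) (e : T -> U) (t : T) :
    closure (range e) :=
  SigSub (mem_set (subset_closure (imageT e t))).

Record input_CEDAP_on (R : realType) (s : scalar_kind) (X : metricType R)
    (K : set X) : Type := InputCEDAPOn {
  in_width : nat -> nat;
  in_enc : forall n, K -> 'rV[scalar_field R s]_(in_width n);
  in_dec : forall n, closure (range (in_enc n)) -> X;
  in_enc_bounded : forall n, bounded_set (range (in_enc n));
  in_dec_continuous : forall n, continuous (@in_dec n);
  in_approx :
    (fun n => sup_ge0 (fun f : K =>
       mdist (\val f) (in_dec (into_closure (in_enc n) f)))) @ \oo --> 0%E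
}.

Record output_CEDAP_on (R : realType) (s : scalar_kind) (Y : metricType R)
    (K : set Y) : Type := OutputCEDAPOn {
  out_width : nat -> nat;
  out_enc : forall n, Y -> 'rV[scalar_field R s]_(out_width n);
  out_dec : forall n, 'rV[scalar_field R s]_(out_width n) -> Y;
  out_enc_continuous : forall n, {within K, continuous (out_enc n)};
  out_dec_unif_continuous : forall n, unif_continuous (@out_dec n);
  out_approx :
    (fun n => sup_ge0 (fun f : K =>
       mdist (\val f) (out_dec (out_enc n (\val f))))) @ \oo --> 0%E
}.

(* The mappings are data, so that a theorem can refer to them. *)
Definition input_CEDAP (R : realType) (s : scalar_kind) (X : metricType R) : Type :=
  forall K : set X, compact K -> input_CEDAP_on s K.

Definition output_CEDAP (R : realType) (s : scalar_kind) (Y : metricType R) : Type :=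
  forall K : set Y, compact K -> output_CEDAP_on s K.

Definition function_family (R : realType) (s : scalar_kind) : Type :=
  forall a b : nat, set ('rV[scalar_field R s]_a -> 'rV[scalar_field R s]_b).

Definition universal_approximator (R : realType) (s : scalar_kind)
    (F : function_family R s) : Prop :=
  forall (a b : nat) (C : set 'rV[scalar_field R s]_a)
    (f : C -> 'rV[scalar_field R s]_b),
    compact C -> continuous f ->
    exists fn : nat -> 'rV[scalar_field R s]_a -> 'rV[scalar_field R s]_b,
      (forall n, F a b (fn n)) /\
      (fun n => sup_ge0 (fun x : C => eucl_norm (f x - fn n (\val x))))
        @ \oo --> 0%E.

(* Main.v *)
(* Write E_n, D_n for the encoders and decoders of X on K, and C_n for the
   compact closure of E_n(K). Every point of D_n(C_n) is within about
   sup_K d(f, D_n(E_n(f))) of K, so the union of K with all the D_n(C_n) is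
   compact, and K' is its image under G. The output encoder on K' after G o D_n
   is then continuous on C_n; phi_n approximates it there closely enough,
   relative to the modulus of uniform continuity of the output decoder, to give
   a decoded error at most 1/(n+1). The error at f splits through G(D_n(E_n(f)))
   and its output reconstruction; the first part tends to 0 because G is
   uniformly continuous at the points of the compact set K. *)
Require Import Defs.
From HB Require Import structures.
From mathcomp Require Import all_boot all_order all_algebra.
From mathcomp Require Import all_classical all_reals all_analysis.
From mathcomp Require Import ring.

Set Implicit Arguments.
Unset Strict Implicit.
Unset Printing Implicit Defensive.

Import Order.TTheory GRing.Theory Num.Theory.

Local Open Scope classical_set_scope.
Local Open Scope ring_scope.

(** * Convergence of suprema to zero *)

Lemma sup_ge0_le (R : realType) (T : Type) (h : T -> R) (e : R) :
  0 <= e -> (sup_ge0 h <= e%:E)%E <-> forall t, h t <= e.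
Proof.
move=> e0; split=> [he t|he].
  rewrite -lee_fin (le_trans _ he)//; apply: ereal_sup_ubound; right.
  by exists t.
by apply: ge_ereal_sup => _ [->|[t _ <-]]; rewrite lee_fin.
Qed.

Lemma sup_ge0_cvg0P (R : realType) (T : Type) (h : nat -> T -> R) :
  (fun n => sup_ge0 (h n)) @ \oo --> 0%E <->
  forall e, 0 < e -> \forall n \near \oo, forall t, h n t <= e.
Proof.
have nbhs0E (A : set (\bar R)) : nbhs 0%E A = nbhs (0 : R) (fun r => A r%:E).
  by [].
split=> [h0 e e0|he].
  have : nbhs (0%E : \bar R) [set x | (x < e%:E)%E].
    rewrite nbhs0E; apply/nbhs_ballP; exists e => //= x.
    by rewrite /ball/= sub0r normrN lte_fin => /ltr_normlW.
  move/h0; rewrite nbhs_simpl /=; apply: filterS => n /ltW hn.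
  exact/sup_ge0_le/hn/ltW.
move=> U; rewrite nbhs0E => /nbhs_ballP[d /= d0 dU].
have := he (d / 2) (divr_gt0 d0 (ltr0n _ 2)).
apply: filterS => n /(sup_ge0_le _ (ltW (divr_gt0 d0 (ltr0n _ 2)))) hn.
(* The inserted 0 bounds the supremum below, so it is a real number even when [T] is empty. *)
have h0 : (0 <= sup_ge0 (h n))%E by apply: ereal_sup_ubound; left.
have hfin : sup_ge0 (h n) \is a fin_num.
  by rewrite ge0_fin_numE// (le_lt_trans hn)// ltry.
move: hn h0; rewrite /= -(fineK hfin) !lee_fin => hn h0; apply: dU.
rewrite /ball/= sub0r normrN ger0_norm// (le_lt_trans hn)//.
by rewrite ltr_pdivrMr// ltr_pMr// ltr1n.
Qed.

(** * Norms and bounded sets over the real or complex scalars *)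

Lemma scalar_abs_ge0 (R : realType) (s : scalar_kind) (x : scalar_field R s) :
  0 <= scalar_abs x.
Proof. by case: s x => [x|[a b]] /=; [exact: normr_ge0|exact: sqrtr_ge0]. Qed.

(** In [R[i]] the order makes a positive [e] real, so its real part serves as the radius. *)
Lemma normr_lt_scalar_abs (R : realType) (s : scalar_kind)
    (e : scalar_field R s) :
  0 < e -> exists2 d : R, 0 < d &
    forall x : scalar_field R s, scalar_abs x < d -> `|x| < e.
Proof.
case: s e => /= e e0; first by exists e.
have eE := RRe_real (gtr0_real e0).
exists (complex.Re e); first by rewrite -ltcR eE.
by move=> x; rewrite -ltcR eE.
Qed.

Lemma entourage_eucl_norm (R : realType) (s : scalar_kind) (a : nat)
    (A : set ('rV[scalar_field R s]_a * 'rV[scalar_field R s]_a)) :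
  entourage A -> exists2 d : R, 0 < d &
    forall v w, eucl_norm (v - w) < d -> A (v, w).
Proof.
rewrite -entourage_ballE => -[e /= e0 eA].
have [d d0 de] := normr_lt_scalar_abs e0; exists d => // v w vwd.
apply: eA; split=> //= i j; rewrite /ball/=; apply: de.
(* Each coordinate is dominated by the Euclidean norm: isolate the [j]-th square in the sum. *)
apply: le_lt_trans vwd; rewrite /eucl_norm (bigD1 j)//= !mxE ord1.
rewrite -[leLHS]ger0_norm ?scalar_abs_ge0// -sqrtr_sqr ler_sqrt ?lerDl.
  by apply: sumr_ge0 => k _; exact: sqr_ge0.
by apply: addr_ge0; [exact: sqr_ge0|apply: sumr_ge0 => k _; exact: sqr_ge0].
Qed.

(** In the complex case the disc lies in a square, the continuous image of a product of two
    segments. *)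
Lemma normr_le_subset_compact (R : realType) (s : scalar_kind)
    (M : scalar_field R s) :
  exists2 B : set (scalar_field R s), compact B & [set x | `|x| <= M] `<=` B.
Proof.
case: s M => /= M.
  exists `[- M, M]%classic; first exact: segment_compact.
  by move=> x; rewrite /= in_itv/= ler_norml.
pose m := complex.Re M; pose I := `[- m, m]%classic : set R.
pose f (p : R * R) : R[i] := Complex p.1 p.2.
exists (f @` (I `*` I)).
  apply: continuous_compact; last first.
    by apply: compact_setX; exact: segment_compact.
  apply: continuous_subspaceT => p U /nbhs_ballP[e /= e0 eU].
  have eE := RRe_real (gtr0_real e0).
  have e2 : 0 < complex.Re e / 2 by rewrite divr_gt0// -ltcR eE.
  apply/nbhs_ballP; exists (complex.Re e / 2) => //= q [pq1 pq2]; apply: eU.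
  rewrite /ball/= -eE normc_def ltcR/=.
  apply: (@le_lt_trans _ _ (`|p.1 - q.1| + `|p.2 - q.2|)); last first.
    by rewrite [ltRHS]splitr ltrD.
  rewrite -[leRHS]ger0_norm ?addr_ge0// -sqrtr_sqr ler_sqrt ?sqr_ge0//.
  rewrite [leRHS]sqrrD !real_normK ?num_real// lerD2r lerDl.
  by rewrite mulrn_wge0// mulr_ge0.
move=> [a b] /= zM.
(* [M] bounds the norm of some point, so it is nonnegative and hence real. *)
have ME : M = m%:C%C.
  by apply/esym/RRe_real/ger0_real/(le_trans _ zM).
exists (a, b) => //; split; rewrite /I/= in_itv/= -ler_norml -lecR -ME;
  apply: le_trans zM.
  exact: (@normc_ge_Re _ (Complex a b)).
rewrite normc_def lecR/= -[leLHS]ger0_norm// -sqrtr_sqr ler_sqrt.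
  by rewrite real_normK ?num_real// lerDr sqr_ge0.
by rewrite addr_ge0 ?sqr_ge0.
Qed.

(** Heine-Borel: a bounded set lies in a finite power of one compact set of scalars. *)
Lemma bounded_compact_closure (R : realType) (s : scalar_kind) (a : nat)
    (A : set 'rV[scalar_field R s]_a) :
  bounded_set A -> compact (closure A).
Proof.
move=> [M [Mreal AM]].
have [B cB MB] := normr_le_subset_compact (M + 1).
rewrite -precompactE; apply: precompact_subset (compact_precompact _ _).
- 2: exact: norm_hausdorff.
- 2: exact: (@rV_compact _ _ (fun=> B)).
have M1 : M < M + 1 by rewrite ltrDl ltr01.
move=> v /(AM _ M1) /= vM i; apply: MB.
apply: le_trans vM.
have -> : `|v| = mx_norm v by [].
rewrite mx_normE (_ : `|v ord0 i| = `|v ord0 i|%:nng%:num)// num_le.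
exact: (@le_bigmax _ _ _ _ (fun ij => `|v ij.1 ij.2|%:nng) (ord0, i)).
Qed.

(** * Compactness and uniform estimates in metric spaces *)

(** A cover of [K] already covers a uniform neighbourhood of [K], which contains all but finitely
    many [L n]; the remaining ones form a finite union of compact sets. *)
Lemma compact_setU_bigcup (R : realType) (X : metricType R) (K : set X)
    (L : nat -> set X) :
  compact K -> (forall n, compact (L n)) ->
  (forall e : R, 0 < e -> \forall n \near \oo,
    forall y, L n y -> exists2 x, K x & mdist x y <= e) ->
  compact (K `|` \bigcup_n L n).
Proof.
move=> cK cL LK; rewrite compact_near_coveringP => I F P FF cov.
(* The radius of the neighbourhood becomes a second parameter of the covering, tending to 0 from the
   right. *)
have [[A B] /= [FA B0] AB] : filter_prod F (0 : R)^'+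
    [set ie | forall x, K x -> forall y, mdist x y <= ie.2 -> P ie.1 y].
  have /compact_near_coveringP KP := cK; apply: (KP _ (filter_prod F (0 : R)^'+)
    (fun ie x => forall y, mdist x y <= ie.2 -> P ie.1 y)) => x Kx.
  have [[/= U V] [/nbhs_ballP[r /= r0 rU] FV] UVP] := cov x (or_introl Kx).
  have r2 : 0 < r / 2 by rewrite divr_gt0.
  exists (ball x (r / 2), (V `*` [set e | e < r / 2])) => /=.
    split; first exact: nbhsx_ballx.
    exists (V, [set e | e < r / 2]) => //=.
    by split => //; exact: nbhs_right_lt.
  move=> [x' [i e]] /= [xx' [Vi er]] y x'y; apply: (UVP (y, i)); split => //=.
  apply: rU; rewrite [r]splitr; apply: ball_triangle xx' _.
  by rewrite ballEmdist/= (le_lt_trans x'y).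
have [e [Be e0]] : exists e, B e /\ 0 < e.
  apply: (@filter_ex _ (0 : R)^'+); apply: filterI => //.
  exact: nbhs_right_gt.
have [N _ NL] := LK e e0.
have FL : F [set i | \big[setU/set0]_(n < N) L n `<=` P i].
  have /compact_near_coveringP LP := @bigsetU_compact X _ (fun n : 'I_N => L n)
    (index_enum 'I_N) xpredT (fun n _ => cL n).
  apply: LP => x.
  by rewrite -bigcup_mkord => -[n _ Lnx]; apply: cov; right; exists n.
apply: filterS (filterI FA FL) => i [Ai Li] y [Ky|[n _ Lny]].
  by apply: (AB (i, e)) Ky _ _ => //=; rewrite mdistxx ltW.
have [nN|Nn] := ltnP n N; first by apply: Li; rewrite -bigcup_mkord; exists n.
have [x Kx xy] := NL n Nn y Lny.
exact: (AB (i, e)) Kx _ xy.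
Qed.

Lemma compact_range_set_type (T U : topologicalType) (C : set T) (f : C -> U) :
  compact C -> continuous f -> compact (range f).
Proof.
move=> cC cf; have [->|/set0P[u _]] := eqVneq (range f) set0.
  exact: compact0.
(* Extend [f] by the constant [u] outside [C]; such a value exists only when the range is
   nonempty. *)
have -> : range f = valL_ u f @` C.
  apply/seteqP; split=> [_ [t _ <-]|_ [t Ct <-]].
    exists (\val t); first exact: set_valP.
    by rewrite -[in RHS](valLK u f).
  by exists (SigSub (mem_set Ct)) => //; rewrite -[in LHS](valLK u f).
by apply: continuous_compact => //; exact/subspace_valL_continuousP'.
Qed.

(** Only [x] is confined to [K]: this applies to reconstructed points [y], which may lie outside
    [K]. *)
Lemma continuous_mdist_le_compact (R : realType) (X Y : metricType R)
    (G : X -> Y) (K : set X) (e : R) :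
  continuous G -> compact K -> 0 < e ->
  exists2 d : R, 0 < d &
    forall x y, K x -> mdist x y < d -> mdist (G x) (G y) <= e.
Proof.
move=> cG cK e0.
have [d [Kd d0]] : exists d : R, (forall x, K x -> forall y, mdist x y < d ->
    mdist (G x) (G y) <= e) /\ 0 < d.
  apply: (@filter_ex _ (0 : R)^'+); apply: filterI; last exact: nbhs_right_gt.
  move/compact_near_coveringP : cK => KP; apply: (KP _ (0 : R)^'+
    (fun d x => forall y, mdist x y < d -> mdist (G x) (G y) <= e)) => x Kx.
  have e2 : 0 < e / 2 by rewrite divr_gt0.
  have /nbhs_ballP[r /= r0 rG] := cG x _ (nbhsx_ballx (G x) _ e2).
  have r2 : 0 < r / 2 by rewrite divr_gt0.
  exists (ball x (r / 2), [set d | d < r / 2]) => /=.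
    by split; [exact: nbhsx_ballx|exact: nbhs_right_lt].
  move=> [x' d] /= [xx' dr] y x'y.
  have Gy : ball (G x) (e / 2) (G y).
    apply: rG; rewrite [r]splitr; apply: ball_triangle xx' _.
    by rewrite ballEmdist/= (lt_trans x'y).
  have Gx' : ball (G x') (e / 2) (G x).
    apply/ball_sym/rG; apply: le_ball xx'.
    by rewrite ler_pdivrMr// ler_peMr ?ltW// ltr1n.
  by have := ball_triangle Gx' Gy; rewrite -splitr ballEmdist => /ltW.
by exists d => // x y /Kd; exact.
Qed.

(** Points of the range are dense in its closure, so continuity of [D] carries the bound over; the
    slack [r - d] absorbs the passage to the limit. *)
Lemma mdist_closure_le (R : realType) (T : Type) (U : topologicalType)
    (X : metricType R) (e : T -> U) (D : closure (range e) -> X) (K : set X)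
    (g : T -> X) (d r : R) :
  continuous D -> d < r ->
  (forall t, K (g t) /\ mdist (g t) (D (into_closure e t)) <= d) ->
  forall c, exists2 x, K x & mdist x (D c) <= r.
Proof.
move=> cD dr gd c.
have rd : 0 < r - d by rewrite subr_gt0.
have [_ [[W oW <-] Wc WD]] := cD c _ (nbhsx_ballx (D c) _ rd).
have [_ [[t _ <-] Wt]] := set_valP c W (open_nbhs_nbhs (conj oW Wc)).
have := WD (into_closure e t) Wt; rewrite /= ballEmdist/= metric_sym => Dt.
have [Kt td] := gd t; exists (g t) => //.
apply: (le_trans (metric_triangle _ (D (into_closure e t)) _)).
by rewrite -lerBrDl (le_trans (ltW Dt))// lerD2l lerN2.
Qed.

(** * Approximation between encoder and decoder *)

Lemma universal_approximator_decoded (R : realType) (s : scalar_kind)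
    (F : function_family R s) (Y : metricType R) (a b : nat)
    (C : set 'rV[scalar_field R s]_a) (f : C -> 'rV[scalar_field R s]_b)
    (D : 'rV[scalar_field R s]_b -> Y) (e : R) :
  universal_approximator F -> compact C -> continuous f ->
  unif_continuous D -> 0 < e ->
  exists phi, F a b phi /\
    forall c : C, mdist (D (f c)) (D (phi (\val c))) <= e.
Proof.
move=> hF cC cf uD e0.
have [d d0 dD] : exists2 d : R, 0 < d &
    forall v w, eucl_norm (v - w) < d -> mdist (D v) (D w) < e.
  apply: (@entourage_eucl_norm _ _ _ [set vw | mdist (D vw.1) (D vw.2) < e]).
  apply: (uD [set xy : Y * Y | mdist xy.1 xy.2 < e]).
  rewrite -entourage_ballE; exists e => // -[x y] /=.
  by rewrite ballEmdist.
have [phi [Fphi /sup_ge0_cvg0P]] := hF a b C f cC cf.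
(* Halving turns the non-strict bound on the supremum into the strict one required by [dD]. *)
have d2 : 0 < d / 2 by rewrite divr_gt0.
move=> /(_ _ d2)[N _ /(_ N (leqnn N)) phid].
exists (phi N); split=> // c; apply/ltW/dD/(le_lt_trans (phid c)).
by rewrite ltr_pdivrMr// ltr_pMr// ltr1n.
Qed.

Theorem theorem4p11 (R : realType) (s : scalar_kind) (X Y : metricType R)
  (cX : input_CEDAP s X) (cY : output_CEDAP s Y)
  (F : function_family R s) (hF : universal_approximator F)
  (G : X -> Y) (hG : continuous G) (K : set X) (cK : compact K) :
  exists (K' : set Y) (cK' : compact K')
    (phi : forall n : nat,
       'rV[scalar_field R s]_(in_width (cX K cK) n) ->
       'rV[scalar_field R s]_(out_width (cY K' cK') n)),
    (forall n, F _ _ (phi n)) /\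
    (fun n => sup_ge0 (fun f : K =>
       mdist (G (\val f))
         ((@out_dec _ _ _ _ (cY K' cK') n \o phi n \o in_enc (cX K cK) n) f)))
      @ \oo --> 0%E.
Proof.
set cXK := cX K cK.
have cC n : compact (closure (range (in_enc cXK n))).
  exact/bounded_compact_closure/in_enc_bounded.
have /sup_ge0_cvg0P approxX := in_approx cXK.
pose L n := range (@in_dec _ _ _ _ cXK n).
have cKL : compact (K `|` \bigcup_n L n).
  apply: compact_setU_bigcup => // [n|e e0].
    by apply: compact_range_set_type => //; exact: in_dec_continuous.
  have e2 : 0 < e / 2 by rewrite divr_gt0.
  apply: filterS (approxX _ e2) => n nX _ [c _ <-].
  apply: (mdist_closure_le (g := set_val) (d := e / 2)).
  - exact: in_dec_continuous.
  - by rewrite ltr_pdivrMr// ltr_pMr// ltr1n.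
  - by move=> t; split; [exact: set_valP|exact: nX].
pose K' := G @` (K `|` \bigcup_n L n).
have cK' : compact K'.
  by apply: continuous_compact => //; exact: continuous_subspaceT.
exists K', cK'; set cYK := cY K' cK'.
have /sup_ge0_cvg0P approxY := out_approx cYK.
have K'dec n c : K' (G (@in_dec _ _ _ _ cXK n c)).
  by exists (in_dec c) => //; right; exists n => //; exists c.
pose h n := out_enc cYK n \o G \o @in_dec _ _ _ _ cXK n.
(* The output encoder is continuous only within [K']; this suffices since [G] after the decoder
   takes its values in [K']. *)
have ch n : continuous (h n).
  have /subspace_continuousP EK' := @out_enc_continuous _ _ _ _ cYK n.
  move=> c U /(EK' _ (K'dec n c)) EU.
  have cGD : {for c, continuous (G \o @in_dec _ _ _ _ cXK n)}.
    by apply: continuous_comp; [exact: in_dec_continuous|exact: hG].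
  have := cGD _ EU; rewrite !nbhs_simpl /=.
  by apply: filterS => c'; apply; exact: K'dec.
have n1_gt0 n : 0 < n.+1%:R^-1 :> R by rewrite invr_gt0.
have phiP n := universal_approximator_decoded hF (cC n) (ch n)
  (@out_dec_unif_continuous _ _ _ _ cYK n) (n1_gt0 n).
pose phi n := projT1 (cid (phiP n)).
exists phi; split=> [n|]; first by have [] := projT2 (cid (phiP n)).
apply/sup_ge0_cvg0P => e e0.
have e3 : 0 < e / 3 by rewrite divr_gt0.
have [d d0 Gd] := continuous_mdist_le_compact hG cK e3.
have d2 : 0 < d / 2 by rewrite divr_gt0.
near=> n => f /=.
set x := in_dec (into_closure (in_enc cXK n) f).
pose y := out_dec (out_enc cYK n (G x)).
apply: (le_trans (metric_triangle _ (G x) _)).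
(* The three errors are from [G f] to [G x], from [G x] to its reconstruction [y], and from [y] to
   the decoded value of [phi n]. *)
rewrite [leRHS](_ : e = e / 3 + (e / 3 + e / 3)); last by field.
apply: lerD.
  apply: Gd; first exact: set_valP.
  apply: (@le_lt_trans _ _ (d / 2)); first by
    (* Generalizing [f] first keeps the threshold on [n] uniform over [K]. *)
    move: f @x @y; near: n; exact: approxX.
  by rewrite ltr_pdivrMr// ltr_pMr// ltr1n.
apply: (le_trans (metric_triangle _ y _)); apply: lerD.
  have xK' := K'dec n (into_closure (in_enc cXK n) f).
  have : forall g : K',
      mdist (\val g) (out_dec (out_enc cYK n (\val g))) <= e / 3.
    by near: n; exact: approxY.
  by move=> /(_ (SigSub (mem_set xK'))).
have [_ /(_ (into_closure (in_enc cXK n) f)) phie] := projT2 (cid (phiP n)).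
apply: (le_trans phie).
by rewrite ltW//; near: n; exact: near_infty_natSinv_lt (PosNum e3).
Unshelve. all: by end_near.
Qed.
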